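(* Let $\epsilon>0$, $\ell\in[L]$, $k\in[n_\ell]$, $j\in[n_{\ell-1}]$, and $W_d^\ell\in\mathcal D^\ell$; let $\hat W^\ell:=W^\ell_{d,kj}$ be the desired memductance value. Let $\gamma$ be a path to the $(k,j)$-th memristor in layer $\ell$. Let $\alpha>0$ and $T>0$ be such that $$T\alpha\le\frac{1}{\beta(\eta W_{\max})^{\ell-1}}.$$ Then, for any initial conditions $\varphi^\kappa_0\in\mathbb{R}^{n_\kappa\times n_{\kappa-1}}$, $\kappa\in[\ell]$, there exists $\hat T^\ell_{kj}\ge 0$ such that the writing controller (described in the context, with parameters $T,\alpha,\epsilon$, path $\gamma$ and any initial nonzero value $x$) achieves $$\bigl|\hat W^\ell-W(\phi^\ell_\gamma(\hat T^\ell_{kj}))\bigr|\le\epsilon,$$ where $\phi_\gamma=(\phi_\gamma^1,\dots,\phi_\gamma^\ell)$ is the solution to the path dynamics under this controller with initial condition $\phi_\gamma^\kappa(0)=(\varphi_0^\kappa)_{\gamma_\kappa,\gamma_{\kappa-1}}$, $\kappa\in[\ell]$.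
   Context: Notation: $[n]=\{1,\dots,n\}$. $L\ge1$ and $n_0,\dots,n_L$ are positive integers (layer sizes); layer $\ell\in[L]$ contains $n_\ell\times n_{\ell-1}$ memristors. Activation function: $\sigma:\mathbb{R}\to\mathbb{R}$ is continuously differentiable, odd, strictly monotone (meaning $(\sigma(x)-\sigma(y))(x-y)>0$ for all $x\ne y$) and $\eta$-Lipschitz continuous, $\eta>0$. Memristors: $g:\mathbb{R}\to\mathbb{R}$ is continuously differentiable with $W(\varphi):=\frac{dg(\varphi)}{d\varphi}>0$ for all $\varphi\in\mathbb{R}$; $W$ is strictly monotone (meaning $(W(x)-W(y))(x-y)>0$ for all $x\ne y$), $\beta$-Lipschitz continuous with $\beta>0$, and there are constants $W_{\max}\ge W_{\min}>0$ with $W_{\max}\ge W(x)\ge W_{\min}$ for all $x\in\mathbb{R}$. For a matrix, $W$ is applied entrywise. The set of realizable memductance matrices of layer $\ell$ is $$\mathcal D^\ell=\{X\in\mathbb{R}_{>0}^{n_\ell\times n_{\ell-1}}\mid \exists\,\varphi^\ell\in\mathbb{R}^{n_\ell\times n_{\ell-1}}:\ X=W(\varphi^\ell)\}.$$ Path: a path to the $(k,j)$-th memristor in layer $\ell$ is a tuple $\gamma=(\gamma_0,\dots,\gamma_\ell)$ with $\gamma_\kappa\in[n_\kappa]$, $\gamma_{\ell-1}=j$, $\gamma_\ell=k$. The switches of the circuit are set so that in each layer $\kappa\in[\ell]$ only the $(\gamma_\kappa,\gamma_{\kappa-1})$ memristor is connected, and layer $\ell+1$ (if any) is entirely disconnected.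 Path dynamics: with these switches, the fluxes $\phi_\gamma^\kappa:=\varphi^\kappa_{\gamma_\kappa,\gamma_{\kappa-1}}$ and row currents $\bar J^\kappa_\gamma:=\bar J^\kappa_{\gamma_\kappa}$, $\kappa\in[\ell]$, obey, for the scalar input voltage $P_\gamma^0(t)$ (applied at column $\gamma_0$ of layer 1), $$\dot\phi_\gamma^\kappa=f^\kappa(\phi_\gamma,P_\gamma^0),\qquad \bar J_\gamma^\kappa=W(\phi_\gamma^\kappa)f^\kappa(\phi_\gamma,P_\gamma^0),\qquad\kappa\in[\ell],$$ where $\phi_\gamma=(\phi_\gamma^1,\dots,\phi_\gamma^\ell)^\top$, $f^1(\phi_\gamma,P_\gamma^0)=P_\gamma^0$ and $f^{\kappa+1}(\phi_\gamma,P_\gamma^0)=\sigma\bigl(W(\phi_\gamma^\kappa)f^\kappa(\phi_\gamma,P_\gamma^0)\bigr)$ for $\kappa\in[\ell-1]$. For piecewise constant inputs, solutions are continuous in $t$ and satisfy the ODE on each interval of constancy. Writing controller: fix $x\ne0$ and apply $P_\gamma^0(t)=x$ for $t\in[0,T]$. Then for $i=1,2,\dots$: measure $\bar J_\gamma^\ell(iT)$ and $\bar J_\gamma^{\ell-1}(iT)$ and form $m_i:=\bar J_\gamma^\ell(iT)/\sigma(\bar J_\gamma^{\ell-1}(iT))$ (this equals $W(\phi_\gamma^\ell(iT))$; for $\ell=1$ the denominator is read as $P_\gamma^0(iT)$). If $|\hat W^\ell-m_i|\le\epsilon$, stop (no voltage is applied thereafter); otherwise apply the constant input $P_\gamma^0(t)=\alpha(\hat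 W^\ell-m_i)$ for $t\in(iT,(i+1)T]$ and continue with $i+1$. *)

(* Defs.v *)
From mathcomp Require Export all_boot all_order all_algebra.
From mathcomp Require Export all_classical all_reals all_analysis.

Set Implicit Arguments.
Unset Strict Implicit.
Unset Printing Implicit Defensive.

Export Order.TTheory GRing.Theory Num.Theory.
Export numFieldNormedType.Exports.

Local Open Scope ring_scope.
Local Open Scope classical_set_scope.

Definition strictly_monotone (R : realType) (h : R -> R) : Prop :=
  forall x y : R, x != y -> 0 < (h x - h y) * (x - y).

Definition continuously_differentiable (R : realType) (h : R -> R) : Prop :=
  (forall x : R, derivable h x 1) /\ continuous h^`().

Record activation (R : realType) (eta : R) (sigma : R -> R) : Prop := {
  activation_C1 : continuously_differentiable sigma;
  activation_odd : forall x : R, sigma (- x) = - sigma x;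
  activation_mono : strictly_monotone sigma;
  activation_eta_gt0 : 0 < eta;
  activation_lip : eta.-lipschitz sigma }.

Definition memductance (R : realType) (g : R -> R) : R -> R := g^`().

Record memristor (R : realType) (beta Wmin Wmax : R) (g : R -> R) : Prop := {
  memristor_C1 : continuously_differentiable g;
  memristor_gt0 : forall x : R, 0 < memductance g x;
  memristor_mono : strictly_monotone (memductance g);
  memristor_beta_gt0 : 0 < beta;
  memristor_lip : beta.-lipschitz (memductance g);
  memristor_Wmin_gt0 : 0 < Wmin;
  memristor_Wmin_max : Wmin <= Wmax;
  memristor_bounds : forall x : R, Wmin <= memductance g x <= Wmax }.

Definition realizable (R : realType) (W : R -> R) (p q : nat) : set 'M[R]_(p, q) :=
  [set X | (forall i j, 0 < X i j) /\ exists Phi : 'M[R]_(p, q), X = map_mx W Phi].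

(* A choice of one node in each of the node layers 0, ..., l, whose sizes are
   n 0, ..., n l; nodes are numbered from 0 within a layer. *)
Definition node_path (n : nat -> nat) (l : nat) : Type :=
  forall i : 'I_l.+1, 'I_(n i).

Definition path_to (n : nat -> nat) (l : nat) (k : 'I_(n l)) (j : 'I_(n l.-1))
    (gamma : node_path n l) : Prop :=
  gamma (inord l.-1) = j :> nat /\ gamma ord_max = k :> nat.

(* The index i : 'I_l stands for the memristor layer i.+1, which lies between
   the node layers i and i.+1. *)
Definition path_entry (R : realType) (n : nat -> nat) (l : nat)
    (gamma : node_path n l) (A : forall i : 'I_l, 'M[R]_(n i.+1, n i))
    (i : 'I_l) : R :=
  A i (gamma (lift ord0 i)) (gamma (widen_ord (leqnSn l) i)).

Section PathDynamics.
Variables (R : realType) (sigma W : R -> R).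

(* A state s of the path assigns to each memristor layer i >= 1 its flux s i;
   on a path to layer l only the values s 1, ..., s l are meaningful. The rate
   and current below are likewise meaningful for layers i >= 1 only. *)
Fixpoint path_rate (s : nat -> R) (p : R) (i : nat) : R :=
  match i with
  | (i'.+1 as i1).+1 => sigma (W (s i1) * path_rate s p i1)
  | _ => p
  end.

Definition path_current (s : nat -> R) (p : R) (i : nat) : R :=
  W (s i) * path_rate s p i.

(* phi i t is the flux in layer i at time t. On an interval of constancy of the
   input the equation is imposed at interior points; at the endpoints the
   one-sided derivatives are then determined by continuity. *)
Definition path_solution (l : nat) (P : R -> R) (phi : nat -> R -> R) : Prop :=
  forall i : nat, (1 <= i <= l)%N ->
    {within `[0, +oo[, continuous (phi i)} /\
    forall a b : R, 0 <= a ->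
      (forall s t : R, a < s < b -> a < t < b -> P s = P t) ->
      forall t : R, a < t < b ->
        is_derive t 1 (phi i) (path_rate (phi^~ t) (P t) i).

(* The ratio m formed from the currents measured at layers l and l - 1. *)
Definition measured_memductance (l : nat) (s : nat -> R) (p : R) : R :=
  path_current s p l /
  (if l == 1%N then p else sigma (path_current s p l.-1)).

Section Controller.
Variables (l : nat) (T alpha eps What x : R) (P : R -> R) (phi : nat -> R -> R).

Definition sample (i : nat) : R :=
  measured_memductance l (phi^~ (i%:R * T)) (P (i%:R * T)).

Definition not_stopped (i : nat) : Prop :=
  forall i' : nat, (1 <= i' <= i)%N -> eps < `|What - sample i'|.

Record writing_controller : Prop := {
  controller_init : forall t : R, 0 <= t <= T -> P t = x;
  controller_continue : forall i : nat, (1 <= i)%N -> not_stopped i ->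
    forall t : R, i%:R * T < t <= i.+1%:R * T -> P t = alpha * (What - sample i);
  controller_stop : forall i : nat, (1 <= i)%N -> not_stopped i.-1 ->
    `|What - sample i| <= eps ->
    forall t : R, i%:R * T < t -> P t = 0 }.

End Controller.

(* The input P and the fluxes phi of the path in closed loop with the writing
   controller, on the time interval [0, +oo[. *)
Record writing_trajectory (l : nat) (T alpha eps What x : R) (init : 'I_l -> R)
    (P : R -> R) (phi : nat -> R -> R) : Prop := {
  trajectory_init : forall i : 'I_l, phi i.+1 0 = init i;
  trajectory_ode : path_solution l P phi;
  trajectory_input : writing_controller l T alpha eps What x P phi }.

End PathDynamics.

(* Main.v *)
Require Import Defs.
From mathcomp Require Import ring lra.

(** Let [z] be a flux whose memductance is the desired value; it exists since
    that value is realizable. As long as the controller runs, the flux of layer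
    [l] moves towards [z] in each period: the error has the sign of the remaining
    distance because the memductance is increasing, and every rate on the path has
    the sign of the input. The condition on [T * alpha] prevents it from
    passing [z]. Its speed is at most [(eta * Wmax) ^+ l.-1] times the input,
    hence the displacement is at most [1 / beta] times the memductance error,
    which is at most the distance to [z] by the Lipschitz property
    ([writing_step]).

    The input of an unstopped controller exceeds [alpha * eps] in absolute value,
    which by monotonicity forces a speed of at least the rate obtained by putting
    [Wmin] in place of all memductances. So the distance to [z] loses a fixed
    positive amount per period ([not_stopped_dist]), and the controller must stop
    within a number [N] of periods that depends on the data only. After the
    stop the flux is at rest ([stopped_at]), so that [N * T] suits all
    trajectories at once.

    For the existence of a trajectory no general theorem on differential
    equations is called for: the rate of a layer only depends on the fluxes of
    lower layers, so for a constant input the fluxes are successive antiderivatives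
    ([constant_input_flow]). The closed loop is obtained by chaining such flows
    ([writing_trajectory_ex]). *)

Set Implicit Arguments.
Unset Strict Implicit.
Unset Printing Implicit Defensive.

Local Open Scope ring_scope.
Local Open Scope classical_set_scope.

(** * Rates along a path *)

Lemma lipschitz_dist (R : realType) (c : R) (f : R -> R) : c.-lipschitz f ->
  forall u v : R, `|f u - f v| <= c * `|u - v|.
Proof. by move=> fc u v; have := fc (u, v); apply. Qed.

Lemma strictly_monotone_homo (R : realType) (h : R -> R) :
  strictly_monotone h -> {homo h : u v / u < v}.
Proof.
move=> hm u v uv; have := hm v u; rewrite gt_eqF // => /(_ isT).
by rewrite pmulr_lgt0 ?subr_gt0.
Qed.

Lemma activation0 (R : realType) (eta : R) (sigma : R -> R) :
  activation eta sigma -> sigma 0 = 0.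
Proof.
move=> hs; apply/eqP; rewrite -[_ == _](mulrn_eq0 _ 2) mulr2n addr_eq0.
by rewrite -(activation_odd hs) oppr0.
Qed.

Lemma activation_homo (R : realType) (eta : R) (sigma : R -> R) :
  activation eta sigma -> {homo sigma : u v / u <= v}.
Proof.
by move=> hs; apply: ltW_homo; exact: strictly_monotone_homo (activation_mono hs).
Qed.

Lemma activation_gt0 (R : realType) (eta : R) (sigma : R -> R) :
  activation eta sigma -> forall y : R, 0 < y -> 0 < sigma y.
Proof.
move=> hs y y0; rewrite -(activation0 hs).
exact: (strictly_monotone_homo (activation_mono hs)).
Qed.

Lemma activation_le (R : realType) (eta : R) (sigma : R -> R) :
  activation eta sigma -> forall y : R, 0 <= y -> sigma y <= eta * y.
Proof.
move=> hs y y0; have := lipschitz_dist (activation_lip hs) y 0.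
rewrite (activation0 hs) !subr0 (ger0_norm y0); apply: le_trans; exact: ler_norm.
Qed.

Lemma path_rateS (R : realType) (sigma W : R -> R) (s : nat -> R) (p : R) (i : nat) :
  path_rate sigma W s p i.+2 =
  sigma (W (s i.+1) * path_rate sigma W s p i.+1).
Proof. by []. Qed.

Lemma path_rateN (R : realType) (eta : R) (sigma W : R -> R) :
  activation eta sigma -> forall (s : nat -> R) (p : R) (i : nat),
  path_rate sigma W s (- p) i = - path_rate sigma W s p i.
Proof.
move=> hs s p; elim=> [|[|i] IH] //.
by rewrite 2!path_rateS IH mulrN (activation_odd hs).
Qed.

Lemma path_rate0 (R : realType) (eta : R) (sigma W : R -> R) :
  activation eta sigma -> forall (s : nat -> R) (i : nat),
  path_rate sigma W s 0 i = 0.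
Proof.
move=> hs s; elim=> [|[|i] IH] //.
by rewrite path_rateS IH mulr0 (activation0 hs).
Qed.

Lemma path_rate_gt0 (R : realType) (eta : R) (sigma W : R -> R) :
  activation eta sigma -> (forall u : R, 0 < W u) ->
  forall (s : nat -> R) (p : R) (i : nat),
  0 < p -> 0 < path_rate sigma W s p i.
Proof.
move=> hs W0 s p i p0; elim: i => [|[|i] IH] //.
by rewrite path_rateS (activation_gt0 hs) // mulr_gt0.
Qed.

Lemma path_rate_sign (R : realType) (eta : R) (sigma W : R -> R) :
  activation eta sigma -> (forall u : R, 0 < W u) ->
  forall (s : nat -> R) (p : R) (i : nat),
  p != 0 -> 0 < p * path_rate sigma W s p i.
Proof.
move=> hs W0 s p i; case: (ltgtP p 0) => // p0 _; last first.
  by rewrite mulr_gt0 // (path_rate_gt0 hs).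
by rewrite -mulrNN -(path_rateN _ hs) mulr_gt0 ?oppr_gt0// (path_rate_gt0 hs)// oppr_gt0.
Qed.

(** As [sigma] is odd, reversing the input reverses every rate along the path;
    comparisons of rates may therefore be made for positive inputs, where
    everything is monotone. *)
Lemma path_rate_norm (R : realType) (eta : R) (sigma W : R -> R) :
  activation eta sigma -> (forall u : R, 0 < W u) ->
  forall (s : nat -> R) (p : R) (i : nat),
  `|path_rate sigma W s p i| = path_rate sigma W s `|p| i.
Proof.
move=> hs W0 s p i; case: (ltgtP p 0) => [p0|p0|->].
- rewrite (ltr0_norm p0) (path_rateN _ hs) ltr0_norm //.
  by rewrite -oppr_gt0 -(path_rateN _ hs) (path_rate_gt0 hs) // oppr_gt0.
- by rewrite (gtr0_norm p0) gtr0_norm // (path_rate_gt0 hs).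
- by rewrite normr0 (path_rate0 _ hs) normr0.
Qed.

(** Constant memductances are allowed here. With [W := fun=> Wmin] the smaller
    rate no longer depends on the state of the path: it is a speed that an input of
    given size is sure to reach in any state. *)
Lemma path_rate_le (R : realType) (eta : R) (sigma W W' : R -> R) :
  activation eta sigma -> (forall u : R, 0 < W u) ->
  (forall u v : R, W u <= W' v) ->
  forall (s s' : nat -> R) (p p' : R) (i : nat), 0 < p -> p <= p' ->
  path_rate sigma W s p i <= path_rate sigma W' s' p' i.
Proof.
move=> hs W0 WW' s s' p p' i p0 pp'; elim: i => [|[|i] IH] //.
rewrite !path_rateS; apply: (activation_homo hs).
by apply: ler_pM => //; [exact/ltW/W0|exact/ltW/(path_rate_gt0 hs)].
Qed.

(** Each layer crossed multiplies the rate by at most [Wmax] (the memristor) and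
    then by at most [eta] (the activation); the input enters layer 1 directly,
    whence the predecessor in the exponent. *)
Lemma path_rate_upper (R : realType) (eta Wmax : R) (sigma W : R -> R) :
  activation eta sigma -> (forall u : R, 0 < W u <= Wmax) ->
  forall (s : nat -> R) (p : R) (i : nat),
  `|path_rate sigma W s p i| <= (eta * Wmax) ^+ i.-1 * `|p|.
Proof.
move=> hs WM s p i.
have W0 u : 0 < W u by case/andP: (WM u).
rewrite (path_rate_norm hs W0); move: `|p| (normr_ge0 p) => {}p.
rewrite le_eqVlt => /predU1P[<-|p0]; first by rewrite (path_rate0 _ hs) mulr0.
elim: i => [|[|i] IH]; rewrite ?expr0 ?mul1r //.
rewrite path_rateS; apply: le_trans (activation_le hs _) _.
  by rewrite ltW// mulr_gt0 // (path_rate_gt0 hs).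
rewrite exprS -!mulrA ler_pM2l ?(activation_eta_gt0 hs)//.
by apply: ler_pM => //; [exact: ltW|exact/ltW/(path_rate_gt0 hs)|case/andP: (WM (s i.+1))].
Qed.

(** A nonzero input makes every rate nonzero, so that the denominator of the
    measured ratio, which is the rate of layer [l], may be cancelled. *)
Lemma measured_memductanceE (R : realType) (eta : R) (sigma W : R -> R) :
  activation eta sigma -> (forall u : R, 0 < W u) ->
  forall (l : nat) (s : nat -> R) (p : R), (1 <= l)%N -> p != 0 ->
  measured_memductance sigma W l s p = W (s l).
Proof.
move=> hs W0 [|[|l]] // s p _ p0; rewrite /measured_memductance /path_current.
  by rewrite eqxx /= mulfK.
rewrite eqSS /= mulfK //.
suff : path_rate sigma W s p l.+2 != 0 by [].
by have := path_rate_sign hs W0 s l.+2 p0; rewrite lt0r mulf_eq0 negb_or => /andP[/andP[]].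
Qed.

(** * Convergence of the writing controller *)

(** The mean value theorem replaces integration of the dynamics: over an interval
    of constant input the displacement of a flux is the length times the rate at
    some intermediate state, and the rate bounds hold at every state. *)
Lemma path_solution_mvt (R : realType) (sigma W : R -> R) (l : nat) (P : R -> R)
    (phi : nat -> R -> R) : path_solution sigma W l P phi ->
  forall (i : nat) (a b c : R), (1 <= i <= l)%N -> 0 <= a -> a < b ->
  (forall t : R, a < t < b -> P t = c) ->
  exists s : nat -> R, phi i b - phi i a = path_rate sigma W s c i * (b - a).
Proof.
move=> sol i a b c il a0 ab Pc; have [cphi dphi] := sol i il.
have [||t tab ->] := @MVT R (phi i) (fun t => path_rate sigma W (phi^~ t) (P t) i) a b ab.
- move=> t; rewrite in_itv /= => tab; apply: (dphi a b) => // s u sab uab.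
  by rewrite !Pc.
- apply: continuous_subspaceW cphi => t /=; rewrite !in_itv /= => /andP[a_t _].
  by rewrite (le_trans a0).
- by exists (phi^~ t); rewrite Pc.
Qed.

Lemma norm_subr_same_sign (R : realType) (d e : R) :
  0 < d * e -> `|e| <= `|d| -> `|d - e| = `|d| - `|e|.
Proof.
case: (ltgtP d 0) => [d0|d0|->]; rewrite ?mul0r ?ltxx //.
- rewrite nmulr_rgt0// => e0; rewrite (ltr0_norm d0) (ltr0_norm e0) => h.
  by rewrite ler0_norm; [ring|lra].
- rewrite pmulr_rgt0// => e0; rewrite (gtr0_norm d0) (gtr0_norm e0) => h.
  by rewrite ger0_norm; lra.
Qed.

(** One period of the controller, from the flux [u] towards a flux [z] with the
    desired memductance. The memductance being increasing, the input pushes the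
    flux towards [z]. The bound on [T * alpha] and the Lipschitz property give
    [beta * `|T * rho| <= `|W z - W u| <= beta * `|z - u|], so the flux cannot
    pass [z], and the distance to [z] drops by exactly the displacement. *)
Lemma writing_step (R : realType) (eta beta Wmin Wmax : R) (sigma W : R -> R) :
  activation eta sigma -> strictly_monotone W -> 0 < beta ->
  beta.-lipschitz W -> 0 < Wmin -> (forall u : R, Wmin <= W u <= Wmax) ->
  forall (l : nat) (T alpha : R), 0 < alpha -> 0 < T ->
  T * alpha <= 1 / (beta * (eta * Wmax) ^+ l.-1) ->
  forall (z u eps : R) (s : nat -> R),
  let rho := path_rate sigma W s (alpha * (W z - W u)) l in
  0 < eps -> eps < `|W z - W u| ->
  `|z - (u + T * rho)| <=
    `|z - u| - T * path_rate sigma (fun=> Wmin) (fun=> 0) (alpha * eps) l.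
Proof.
move=> hs Wm beta0 Wlip Wmin0 Wb l T alpha alpha0 T0 hT z u eps s rho eps0 epsW.
have W0 v : 0 < W v by apply: lt_le_trans Wmin0 _; case/andP: (Wb v).
have WM v : 0 < W v <= Wmax by rewrite W0; case/andP: (Wb v).
have e0 : W z - W u != 0 by rewrite -normr_gt0 (lt_trans eps0).
have zu : z != u by apply: contra_neq e0 => ->; rewrite subrr.
have K0 : 0 < (eta * Wmax) ^+ l.-1.
  rewrite exprn_gt0// mulr_gt0 ?(activation_eta_gt0 hs)//.
  by apply: lt_le_trans (W0 0) _; case/andP: (Wb 0).
have rho_sign : 0 < (W z - W u) * rho.
  have := path_rate_sign hs W0 s l (mulf_neq0 (lt0r_neq0 alpha0) e0).
  by rewrite -mulrA pmulr_rgt0.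
have drho_sign : 0 < (z - u) * (T * rho).
  have := mulr_gt0 (Wm _ _ zu) rho_sign.
  rewrite [ltRHS](_ : _ = (W z - W u) ^+ 2 * ((z - u) * rho)); last by ring.
  by rewrite pmulr_rgt0 ?exprn_even_gt0// [X in _ -> 0 < X]mulrCA (pmulr_rgt0 _ T0).
have rho_le : `|T * rho| <= `|z - u|.
  rewrite -(ler_pM2l beta0); apply: le_trans (lipschitz_dist Wlip z u).
  rewrite normrM (gtr0_norm T0).
  have := path_rate_upper hs WM s (alpha * (W z - W u)) l.
  rewrite -/rho normrM (gtr0_norm alpha0) => rho_up.
  apply: (@le_trans _ _ (beta * (T * ((eta * Wmax) ^+ l.-1 * (alpha * `|W z - W u|))))).
    by rewrite !ler_pM2l.
  rewrite [leLHS](_ : _ = T * alpha * (beta * (eta * Wmax) ^+ l.-1) * `|W z - W u|);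
    last by ring.
  rewrite ler_piMl// -ler_pdivlMr//; exact: mulr_gt0.
rewrite opprD addrA (norm_subr_same_sign drho_sign rho_le) lerD2l lerN2.
rewrite normrM (gtr0_norm T0) ler_pM2l// (path_rate_norm hs W0).
apply: (path_rate_le hs) => [v|v w||] //.
- by case/andP: (Wb w).
- exact: mulr_gt0.
- by rewrite normrM (gtr0_norm alpha0) ler_pM2l// ltW.
Qed.

Lemma not_stopped_leq (R : realType) (sigma W : R -> R) (l : nat) (T eps What : R)
    (P : R -> R) (phi : nat -> R -> R) (i i' : nat) : (i' <= i)%N ->
  not_stopped sigma W l T eps What P phi i ->
  not_stopped sigma W l T eps What P phi i'.
Proof. by move=> ii' ns m /andP[m1 mi]; apply: ns; rewrite m1 (leq_trans mi). Qed.

Lemma first_stop (R : realType) (sigma W : R -> R) (l : nat) (T eps What : R)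
    (P : R -> R) (phi : nat -> R -> R) (N : nat) :
  ~ not_stopped sigma W l T eps What P phi N ->
  exists2 i : nat, (1 <= i <= N)%N &
    not_stopped sigma W l T eps What P phi i.-1 /\
    `|What - sample sigma W l T P phi i| <= eps.
Proof.
elim: N => [|N IH] stopped.
  by exfalso; apply: stopped => i' /andP[i1 i0]; move: (leq_trans i1 i0).
have [ns|/IH[i /andP[i1 iN] stop_i]] :=
  pselect (not_stopped sigma W l T eps What P phi N); last first.
  by exists i => //; rewrite i1 leqW.
exists N.+1; rewrite ?leqnn//; split=> //.
rewrite leNgt; apply/negP => epsN; apply: stopped => i' /andP[i1].
by rewrite leq_eqVlt => /predU1P[->//|iN]; apply: ns; rewrite i1.
Qed.

(** While the controller has not stopped, the input present at a sampling time is
    nonzero: it is [x] at first, and later a multiple of an error larger than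
    [eps]. The sample then is the true memductance. *)
Lemma controller_sampleE (R : realType) (eta : R) (sigma W : R -> R) :
  activation eta sigma -> (forall u : R, 0 < W u) ->
  forall (l : nat) (T alpha eps What x : R) (P : R -> R) (phi : nat -> R -> R),
  (1 <= l)%N -> 0 < T -> 0 < alpha -> 0 < eps -> x != 0 ->
  writing_controller sigma W l T alpha eps What x P phi ->
  forall i : nat, not_stopped sigma W l T eps What P phi i ->
  sample sigma W l T P phi i.+1 = W (phi l (i.+1%:R * T)).
Proof.
move=> hs W0 l T alpha eps What x P phi l1 T0 alpha0 eps0 x0 ctrl i ns.
apply: (measured_memductanceE hs) => //; case: i ns => [|i] ns.
  by rewrite (controller_init ctrl) // mul1r lexx ltW.
rewrite (controller_continue ctrl _ ns) //; last first.
  by rewrite ltr_pM2r// ltr_nat ltnSn lexx.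
apply: mulf_neq0; first exact: lt0r_neq0.
rewrite -normr_gt0 (lt_trans eps0)//.
by apply: ns; rewrite leqnn.
Qed.

(** The right-hand side involves the trajectory only through its initial value and
    becomes negative for large [i]: this bounds the number of steps before the
    controller stops, uniformly over all trajectories. The summand with [`|x|]
    accounts for the initial period, in which the input may drive the flux away
    from [z]. *)
Lemma not_stopped_dist (R : realType) (eta beta Wmin Wmax : R) (sigma W : R -> R) :
  activation eta sigma -> strictly_monotone W -> 0 < beta ->
  beta.-lipschitz W -> 0 < Wmin -> (forall u : R, Wmin <= W u <= Wmax) ->
  forall (l : nat) (T alpha eps x z : R) (init : 'I_l -> R)
    (P : R -> R) (phi : nat -> R -> R),
  (1 <= l)%N -> 0 < T -> 0 < alpha -> 0 < eps -> x != 0 ->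
  T * alpha <= 1 / (beta * (eta * Wmax) ^+ l.-1) ->
  writing_trajectory sigma W T alpha eps (W z) x init P phi ->
  forall i : nat, not_stopped sigma W l T eps (W z) P phi i ->
  `|z - phi l (i.+1%:R * T)| <=
    `|z - phi l 0| + T * ((eta * Wmax) ^+ l.-1 * `|x|) -
    i%:R * (T * path_rate sigma (fun=> Wmin) (fun=> 0) (alpha * eps) l).
Proof.
move=> hs Wm beta0 Wlip Wmin0 Wb l T alpha eps x z init P phi l1 T0 alpha0 eps0 x0 hT traj.
have W0 v : 0 < W v by apply: lt_le_trans Wmin0 _; case/andP: (Wb v).
have WM v : 0 < W v <= Wmax by rewrite W0; case/andP: (Wb v).
have ctrl := trajectory_input traj.
elim=> [|i IH] ns.
- rewrite mul0r subr0 mul1r.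
  have [|||s hphi] := @path_solution_mvt _ _ _ _ _ _ (trajectory_ode traj) l 0 T x _ _ T0.
  + by rewrite l1 leqnn.
  + by [].
  + by move=> t /andP[t0 tT]; rewrite (controller_init ctrl)// !ltW.
  rewrite (_ : z - _ = z - phi l 0 - (phi l T - phi l 0)); last by ring.
  apply: le_trans (ler_normB _ _) _; rewrite lerD2l hphi subr0 normrM mulrC.
  by rewrite (gtr0_norm T0) ler_pM2l// path_rate_upper.
- have ns' := not_stopped_leq (leqnSn i) ns.
  have iT : i.+1%:R * T < i.+2%:R * T by rewrite ltr_pM2r// ltr_nat.
  have samp := controller_sampleE hs W0 l1 T0 alpha0 eps0 x0 ctrl ns'.
  have epsW : eps < `|W z - W (phi l (i.+1%:R * T))|.
    by rewrite -samp; apply: ns; rewrite leqnn.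
  have [||t tT|s hphi] := @path_solution_mvt _ _ _ _ _ _ (trajectory_ode traj) l
    (i.+1%:R * T) (i.+2%:R * T) (alpha * (W z - W (phi l (i.+1%:R * T)))) _ _ iT.
  + by rewrite l1 leqnn.
  + by rewrite mulr_ge0// ltW.
  + rewrite (controller_continue ctrl (i := i.+1)) ?samp//.
    by case/andP: tT => -> /ltW.
  rewrite (_ : phi l (i.+2%:R * T) = phi l (i.+1%:R * T) +
    T * path_rate sigma W s (alpha * (W z - W (phi l (i.+1%:R * T)))) l); last first.
    by rewrite addrC -[LHS](subrK (phi l (i.+1%:R * T))) hphi; congr (_ + _);
      rewrite -mulrBl -natrB// subSnn mul1r mulrC.
  apply: le_trans (writing_step hs Wm beta0 Wlip Wmin0 Wb alpha0 T0 hT s eps0 epsW) _.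
  by rewrite [i.+1%:R in leRHS]mulrSr mulrDl mul1r opprD addrA lerD2r IH.
Qed.

(** Once the controller has stopped the input is zero, hence all rates vanish and
    the flux of layer [l] keeps the value it had when the last sample was taken. *)
Lemma stopped_at (R : realType) (eta : R) (sigma W : R -> R) :
  activation eta sigma -> (forall u : R, 0 < W u) ->
  forall (l : nat) (T alpha eps What x : R) (init : 'I_l -> R)
    (P : R -> R) (phi : nat -> R -> R) (N : nat),
  (1 <= l)%N -> 0 < T -> 0 < alpha -> 0 < eps -> x != 0 ->
  writing_trajectory sigma W T alpha eps What x init P phi ->
  ~ not_stopped sigma W l T eps What P phi N ->
  `|What - W (phi l (N%:R * T))| <= eps.
Proof.
move=> hs W0 l T alpha eps What x init P phi N l1 T0 alpha0 eps0 x0 traj.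
have ctrl := trajectory_input traj.
move=> /first_stop[[//|i] /andP[_ iN] [ns stop_i]].
suff -> : phi l (N%:R * T) = phi l (i.+1%:R * T).
  by rewrite -(controller_sampleE hs W0 l1 T0 alpha0 eps0 x0 ctrl ns).
move: iN; rewrite leq_eqVlt => /predU1P[->//|iN].
have [|||t /andP[tT _]|s] := @path_solution_mvt _ _ _ _ _ _ (trajectory_ode traj) l
    (i.+1%:R * T) (N%:R * T) 0.
- by rewrite l1 leqnn.
- by rewrite mulr_ge0// ltW.
- by rewrite ltr_pM2r// ltr_nat.
- exact: (controller_stop ctrl (i := i.+1)).
- by rewrite (path_rate0 _ hs) mul0r => /eqP; rewrite subr_eq0 => /eqP.
Qed.

(** * Existence of a closed-loop trajectory *)

(** The lower bound -1 of the integral leaves room for two-sided derivatives at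
    time 0. *)
Lemma antiderivative_ex (R : realType) (f : R -> R) (a : R) : continuous f ->
  exists F : R -> R, F 0 = a /\ forall t : R, -1 < t -> is_derive t 1 F (f t).
Proof.
move=> fc; pose G (t : R) := (\int[lebesgue_measure]_(u in `[-1, t]) f u)%R.
have G' (t : R) : -1 < t -> is_derive t 1 G (f t).
  move=> t1; have tt : t < t + 1 by rewrite ltrDl.
  have fi : lebesgue_measure.-integrable `[-1, t + 1] (EFin \o f).
    apply: continuous_compact_integrable; first exact: segment_compact.
    exact: continuous_subspaceT.
  have [dG Gf] := continuous_FTC1_closed tt fi t1 (fc t).
  by rewrite -Gf derive1E; apply: DeriveDef.
exists (fun t => a + (G t - G 0)); split; first by rewrite subrr addr0.
move=> t t1; have ? := G' _ t1.
by apply: is_derive_eq; rewrite add0r subr0 mul1r.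
Qed.

Lemma is_derive_cvg (R : realType) (f : R -> R) (t d : R) :
  is_derive t 1 f d -> e^-1 *: ((f \o shift t) (e *: 1) - f t) @[e --> 0^'] --> d.
Proof. by move=> [fd <-]; exact: fd. Qed.

(** Near the end of a period the trajectory follows one branch before and another
    one after; they agree to first order when the input does not change. *)
Lemma is_derive_glue (R : realType) (f g h : R -> R) (t d : R) :
  is_derive t 1 f d -> is_derive t 1 g d -> f t = h t -> g t = h t ->
  (\forall u \near t, h u = f u \/ h u = g u) -> is_derive t 1 h d.
Proof.
move=> /is_derive_cvg fd /is_derive_cvg gd ft gt hfg.
have hd : e^-1 *: ((h \o shift t) (e *: 1) - h t) @[e --> 0^'] --> d.
  move=> U Ud; have := fd _ Ud; have := gd _ Ud => gU fU.
  have hU : \forall e \near 0^', h (e *: 1 + t) = f (e *: 1 + t) \/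
                                 h (e *: 1 + t) = g (e *: 1 + t).
    have : (fun e : R => e *: (1 : R) + t) @ 0^' --> t.
      rewrite -[X in _ --> X]add0r -[X in _ --> X + _](scale0r (1 : R)).
      apply: cvgD; last exact: cvg_cst.
      apply: cvgZr_tmp; exact: cvg_within.
    by move/(_ _ hfg).
  change (\forall e \near 0^', U (e^-1 *: ((h \o shift t) (e *: 1) - h t))).
  apply: filterS3 hU gU fU => e /= -[] -> gU fU; last by rewrite -gt.
  by rewrite -ft.
apply: DeriveDef; first exact: cvgP hd.
exact: cvg_lim hd.
Qed.

Lemma continuous_glue (R : realType) (f g h : R -> R) (t : R) :
  {for t, continuous f} -> {for t, continuous g} -> f t = h t -> g t = h t ->
  (\forall u \near t, h u = f u \/ h u = g u) -> {for t, continuous h}.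
Proof.
move=> fc gc ft gt hfg U Uht.
have fU : \forall u \near t, U (f u) by apply: fc; rewrite ft.
have gU : \forall u \near t, U (g u) by apply: gc; rewrite gt.
by apply: filterS3 hfg fU gU => u /= -[] ->.
Qed.

Lemma is_derive_continuous (R : realType) (f : R -> R) (t d : R) :
  is_derive t 1 f d -> {for t, continuous f}.
Proof. by move=> fd; apply/differentiable_continuous/derivable1_diffP/ex_derive. Qed.

Lemma is_derive_subr (R : realType) (f : R -> R) (a t d : R) :
  is_derive (t - a) 1 f d -> is_derive t 1 (fun u => f (u - a)) d.
Proof.
move=> fd; rewrite -[d]mulr1.
apply: (@is_derive1_comp _ f (fun u => u - a) t d 1 fd).
by apply: is_derive_eq; rewrite subr0.
Qed.

(** The rate of layer [i] under the constant input [c], as a function of time. It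
    only involves the fluxes of lower layers, so the equations are solved one
    after the other: [A (r, a)] is meant to be the antiderivative of [r] with
    value [a] at 0. Antiderivatives are only controlled after time -1, and taking
    them at [`|t|] yields rates that are continuous on the whole line without
    changing them at nonnegative times. *)
Fixpoint flow_rate (R : realType) (sigma W : R -> R)
    (A : (R -> R) * R -> R -> R) (s : nat -> R) (c : R) (i : nat) : R -> R :=
  match i with
  | (i'.+1 as i1).+1 => fun t => let r := flow_rate sigma W A s c i1 in
      sigma (W (A (r, s i1) `|t|) * r t)
  | _ => fun=> c
  end.

Lemma constant_input_flow (R : realType) (sigma W : R -> R) :
  continuous sigma -> continuous W -> forall (s : nat -> R) (c : R),
  exists F : nat -> R -> R, forall i : nat, F i 0 = s i /\
    forall t : R, 0 <= t ->
      is_derive t 1 (F i) (path_rate sigma W (F^~ t) c i).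
Proof.
move=> sc Wc s c.
have [A AP] : exists A : (R -> R) * R -> R -> R, forall fa, continuous fa.1 ->
    A fa 0 = fa.2 /\ forall t : R, -1 < t -> is_derive t 1 (A fa) (fa.1 t).
  have ex (fa : (R -> R) * R) : exists F : R -> R, continuous fa.1 ->
      F 0 = fa.2 /\ forall t : R, -1 < t -> is_derive t 1 F (fa.1 t).
    case: fa => f a; have [fc|nfc] := pselect (continuous f).
      by have [F FP] := antiderivative_ex a fc; exists F.
    by exists f.
  by have [A AP] := choice ex; exists A.
pose r := flow_rate sigma W A s c.
have rS i t : r i.+2 t = sigma (W (A (r i.+1, s i.+1) `|t|) * r i.+1 t) by [].
have ltN1 (t : R) : 0 <= t -> -1 < t by apply: lt_le_trans; rewrite oppr_lt0.
have rc i : continuous (r i).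
  elim: i => [|[|i] IH] t; [exact: cvg_cst|exact: cvg_cst|].
  rewrite (_ : r i.+2 = sigma \o (fun t => W (A (r i.+1, s i.+1) `|t|) * r i.+1 t)) //.
  apply: continuous_comp; last exact: sc.
  apply: continuousM; last exact: IH.
  apply: (@continuous_comp _ _ _ (fun u => A (r i.+1, s i.+1) `|u|)); last exact: Wc.
  apply: continuous_comp; first exact: norm_continuous.
  by apply: is_derive_continuous; apply: (AP (r i.+1, s i.+1) IH).2; apply: ltN1.
exists (fun i => A (r i, s i)) => i; split; first exact: (AP (r i, s i) (rc i)).1.
move=> t t0; rewrite [path_rate _ _ _ _ _](_ : _ = r i t); last first.
  by elim: i => [|[|i] IH] //; rewrite rS path_rateS IH ger0_norm.
by apply: (AP (r i, s i) (rc i)).2; apply: ltN1.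
Qed.

(** Periods are half-open on the left, as the input of the controller is updated
    just after a sample; the first period is extended to all earlier times so that
    the initial time causes no discontinuity. *)
Lemma time_slot (R : realType) (T : R) : 0 < T ->
  exists slot : R -> nat, (forall t : R, t <= T -> slot t = 0%N) /\
    (forall t : R, 0 < t -> (slot t)%:R * T < t) /\
    (forall t : R, t <= (slot t).+1%:R * T) /\
    (forall (i : nat) (t : R), i%:R * T < t <= i.+1%:R * T -> slot t = i).
Proof.
move=> T0.
have ex t : exists i : nat, t <= i.+1%:R * T.
  exists (Num.bound `|t / T|); rewrite -ler_pdivrMr//.
  apply: le_trans (ler_norm _) _; apply: ltW; apply: lt_trans (archi_boundP _) _ => //.
  by rewrite ltr_nat.
exists (fun t => ex_minn (ex t)); split=> [t tT|].
  by case: ex_minnP => i _ /(_ 0%N); rewrite mul1r tT leqn0 => /(_ isT)/eqP.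
split=> [t t0|]; last split=> [t|i t /andP[it ti]].
- case: ex_minnP => -[|i] _; first by rewrite mul0r.
  by move=> /(_ i); rewrite ltnn ltNge; case: (t <= _) => // /(_ isT).
- by case: ex_minnP.
- case: ex_minnP => m mt m_min; apply/eqP; rewrite eqn_leq m_min //=.
  by have := lt_le_trans it mt; rewrite ltr_pM2r// ltr_nat ltnS.
Qed.

(** The delicate instants are the ends of periods: an interval on which the input
    is constant may contain such an instant, but then the inputs of both periods
    coincide and the two branches have the same derivative there. *)
Lemma glued_path_solution (R : realType) (sigma W : R -> R) (T : R)
    (slot : R -> nat) (c : nat -> R) (F : nat -> nat -> R -> R) (l : nat) :
  0 < T ->
  (forall t : R, t <= T -> slot t = 0%N) ->
  (forall t : R, 0 < t -> (slot t)%:R * T < t) ->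
  (forall t : R, t <= (slot t).+1%:R * T) ->
  (forall (i : nat) (t : R), i%:R * T < t <= i.+1%:R * T -> slot t = i) ->
  (forall m i : nat, F m.+1 i 0 = F m i T) ->
  (forall (m i : nat) (t : R), 0 <= t ->
     is_derive t 1 (F m i) (path_rate sigma W ((F m)^~ t) (c m) i)) ->
  path_solution sigma W l (fun t => c (slot t))
    (fun i t => F (slot t) i (t - (slot t)%:R * T)).
Proof.
move=> T0 slot0 slot_lt slot_ge slotE FT F' i _.
pose phi (i : nat) (t : R) := F (slot t) i (t - (slot t)%:R * T).
rewrite -/(phi i).
have slotT m : (m.+1%:R : R) * T = m%:R * T + T by rewrite mulrSr mulrDl mul1r.
have slot_le t : 0 <= t -> (slot t)%:R * T <= t.
  rewrite le_eqVlt => /predU1P[<-|/slot_lt/ltW//].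
  by rewrite slot0 ?mul0r// ltW.
(* m is the branch on the left of t, m' the branch on its right. *)
have loc t : 0 <= t -> let m := slot t in exists m', [/\
    m'%:R * T <= t,
    (fun j => F m' j (t - m'%:R * T)) = phi^~ t,
    \forall u \near t, phi i u = F m i (u - m%:R * T) \/
                       phi i u = F m' i (u - m'%:R * T) &
    m' = m \/ t = m.+1%:R * T /\ m' = m.+1].
  move=> t0 m.
  have near_m : \forall u \near t, slot u = m \/ m%:R * T < u.
    have [tT|Tt] := ltP t T.
      have := lt_nbhsl tT; apply: filterS => u uT; left.
      by rewrite /m !slot0// ltW.
    have := lt_nbhsr (slot_lt t (lt_le_trans T0 Tt)); apply: filterS => u; by right.
  have := slot_ge t; rewrite -/m le_eqVlt => /predU1P[tm|tm].
    exists m.+1; split; [by rewrite -tm| | |by right].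
      apply/funext => j; rewrite {1}tm subrr FT /phi -/m; congr (F m j _).
      by rewrite {1}tm slotT; ring.
    have : \forall u \near t, u < m.+2%:R * T.
      by apply: lt_nbhsl; rewrite tm ltr_pM2r// ltr_nat.
    apply: filterS2 near_m => u [um _|um um2]; first by left; rewrite /phi um.
    have [u1|u1] := leP u (m.+1%:R * T); [left|right]; rewrite /phi.
      by rewrite (slotE m) // um.
    by rewrite (slotE m.+1)// u1 ltW.
  exists m; split; [exact: slot_le|by []| |by left].
  have := lt_nbhsl tm; apply: filterS2 near_m => u [um _|um um1].
    by left; rewrite /phi um.
  by left; rewrite /phi (slotE m)// um ltW.
have dF m t : m%:R * T <= t -> is_derive t 1 (fun u => F m i (u - m%:R * T))
    (path_rate sigma W (fun j => F m j (t - m%:R * T)) (c m) i).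
  by move=> mt; apply: is_derive_subr; apply: F'; rewrite subr_ge0.
split.
  apply: continuous_in_subspaceT => t; rewrite inE /= in_itv /= andbT => t0.
  have [m' [m't Fm' near_t _]] := loc t t0.
  apply: (continuous_glue _ _ _ _ near_t).
  - exact: is_derive_continuous (dF _ _ (slot_le _ t0)).
  - exact: is_derive_continuous (dF _ _ m't).
  - by [].
  - exact: (congr1 (fun s => s i) Fm').
move=> a b a0 Pc t /[dup] tab /andP[a_t t_b].
have t0 : 0 <= t by rewrite ltW// (le_lt_trans a0).
have [m' [m't Fm' near_t m'E]] := loc t t0.
(* When t ends a period, compare the inputs at t and at some u just after t. *)
have cm' : c m' = c (slot t).
  case: m'E => [-> //|[tm ->]]; have T1 : t < t + T by rewrite ltrDl.
  have [u tu] : exists u, t < u < Num.min b (t + T).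
    by exists ((t + Num.min b (t + T)) / 2); rewrite !midf_lt// lt_min t_b.
  move: tu; rewrite lt_min => /and3P[tu ub uT].
  have /= -> := Pc t u tab; last by rewrite ub (lt_trans a_t).
  by rewrite (slotE (slot t).+1 u)// (slotT (slot t).+1) -tm tu ltW.
apply: (is_derive_glue _ _ _ _ near_t).
- exact: dF (slot_le _ t0).
- by rewrite -cm' -Fm'; exact: dF.
- by [].
- exact: (congr1 (fun s => s i) Fm').
Qed.

(** The closed loop is a recursion on the pair formed of the fluxes at the start of
    a period and of the input during that period. *)
Lemma writing_trajectory_ex (R : realType) (sigma W : R -> R) :
  continuous sigma -> continuous W ->
  forall (l : nat) (T alpha eps What x : R) (init : 'I_l -> R),
  0 < T -> 0 < alpha -> 0 < eps -> x != 0 ->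
  exists (P : R -> R) (phi : nat -> R -> R),
    writing_trajectory sigma W T alpha eps What x init P phi.
Proof.
move=> sc Wc l T alpha eps What x init T0 alpha0 eps0 x0.
have [Flow FlowP] := choice (fun sp : (nat -> R) * R =>
  constant_input_flow sc Wc sp.1 sp.2).
have [slot [slot0 [slot_lt [slot_ge slotE]]]] := time_slot T0.
pose s0 i := if i is i'.+1 then oapp init 0 (insub i') else 0.
(* A zero input serves as the mark that the controller has stopped: before that,
   every input is nonzero. *)
pose next (st : (nat -> R) * R) : (nat -> R) * R :=
  let s := fun i => Flow st i T in
  let e := What - measured_memductance sigma W l s st.2 in
  (s, if (st.2 == 0) || (`|e| <= eps) then 0 else alpha * e).
pose st m := iter m next (s0, x).
pose P t := (st (slot t)).2.
pose phi i t := Flow (st (slot t)) i (t - (slot t)%:R * T).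
have sampleE m : sample sigma W l T P phi m.+1 =
    measured_memductance sigma W l (st m.+1).1 (st m).2.
  rewrite /sample /P; congr (measured_memductance _ _ _ _ (st _).2); last first.
    by apply: slotE; rewrite lexx ltr_pM2r// ltr_nat ltnSn.
  apply/funext => i; rewrite /phi (slotE m).
    by rewrite -mulrBl -natrB// subSnn mul1r.
  by rewrite lexx ltr_pM2r// ltr_nat ltnSn.
have inputS m : (st m.+1).2 =
    if ((st m).2 == 0) || (`|What - sample sigma W l T P phi m.+1| <= eps) then 0
    else alpha * (What - sample sigma W l T P phi m.+1).
  by rewrite sampleE.
have input_neq0 m : not_stopped sigma W l T eps What P phi m -> (st m).2 != 0.
  elim: m => [//|m IH] ns; rewrite inputS.
  have epsm : eps < `|What - sample sigma W l T P phi m.+1|.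
    by apply: ns; rewrite leqnn.
  rewrite (negPf (IH (not_stopped_leq (leqnSn m) ns))) /=.
  rewrite leNgt epsm /= mulf_eq0 negb_or gt_eqF//= -normr_gt0.
  exact: lt_trans epsm.
exists P, phi; split.
- move=> i; rewrite /phi slot0 ?ltW// mul0r subr0 (FlowP (st 0%N) i.+1).1 /=.
  by rewrite insubT //= => ?; congr (init _); exact: val_inj.
- apply: (@glued_path_solution R sigma W T slot (fun m => (st m).2)
    (fun m => Flow (st m)) l) => //.
  + by move=> m i; rewrite (FlowP (st m.+1) i).1.
  + by move=> m i; exact: (FlowP (st m) i).2.
split.
- by move=> t /andP[_ tT]; rewrite /P slot0.
- move=> [//|i] _ ns t it; rewrite /P (slotE _ _ it) inputS.
  rewrite (negPf (input_neq0 i (not_stopped_leq (leqnSn i) ns))) /=.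
  by rewrite leNgt ns// leqnn.
- move=> [//|i] _ ns stop_i t it; rewrite /P.
  have : (i < slot t)%N.
    by have := lt_le_trans it (slot_ge t); rewrite ltr_pM2r// ltr_nat ltnS.
  elim: (slot t) => [//|m IH]; rewrite ltnS leq_eqVlt inputS => /predU1P[<-|im].
    by rewrite stop_i orbT.
  by rewrite (IH im) eqxx.
Qed.

Theorem theorem3 (R : realType) (L : nat) (n : nat -> nat)
  (hL : (1 <= L)%N) (hn : forall i : nat, (i <= L)%N -> (0 < n i)%N)
  (eta : R) (sigma : R -> R) (hsigma : activation eta sigma)
  (beta Wmin Wmax : R) (g : R -> R) (hg : memristor beta Wmin Wmax g)
  (eps : R) (heps : 0 < eps)
  (l : nat) (hl : (1 <= l <= L)%N)
  (k : 'I_(n l)) (j : 'I_(n l.-1))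
  (Wd : 'M[R]_(n l, n l.-1)) (hWd : realizable (memductance g) Wd)
  (gamma : node_path n l) (hgamma : path_to k j gamma)
  (alpha T : R) (halpha : 0 < alpha) (hT : 0 < T)
  (hTalpha : T * alpha <= 1 / (beta * (eta * Wmax) ^+ l.-1))
  (phi0 : forall i : 'I_l, 'M[R]_(n i.+1, n i))
  (x : R) (hx : x != 0) :
  (* [traj P phi]: P, phi is the closed-loop trajectory; it exists, and all
     such trajectories satisfy the bound at one common time *)
  let traj := writing_trajectory sigma (memductance g) T alpha eps (Wd k j) x
                (path_entry gamma phi0) in
  exists That : R, 0 <= That /\
    (exists (P : R -> R) (phi : nat -> R -> R), traj P phi) /\
    (forall (P : R -> R) (phi : nat -> R -> R), traj P phi ->
       `|Wd k j - memductance g (phi l That)| <= eps).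
Proof.
move=> traj.
have hs := hsigma.
have [_ W0 Wm beta0 Wlip Wmin0 _ Wb] := hg.
have sc : continuous sigma.
  move=> u; apply/differentiable_continuous/derivable1_diffP.
  exact: (activation_C1 hs).1.
have Wc : continuous (memductance g) := (memristor_C1 hg).2.
have l1 : (1 <= l)%N by case/andP: hl.
have [z Wz] : exists z, Wd k j = memductance g z.
  by have [_ [Phi ->]] := hWd; exists (Phi k j); rewrite mxE.
have last_lt : (l.-1 < l)%N by rewrite prednK.
pose u0 := path_entry gamma phi0 (Ordinal last_lt).
pose r := path_rate sigma (fun=> Wmin) (fun=> 0) (alpha * eps) l.
have r0 : 0 < r by apply: (path_rate_gt0 hs) => //; exact: mulr_gt0.
pose B := `|z - u0| + T * ((eta * Wmax) ^+ l.-1 * `|x|).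
pose N := Num.bound `|B / (T * r)|.
have BN : B < N%:R * (T * r).
  rewrite -ltr_pdivrMr ?mulr_gt0//; apply: le_lt_trans (ler_norm _) _.
  exact: archi_boundP.
exists (N%:R * T); split; first by rewrite mulr_ge0// ltW.
split; first exact: writing_trajectory_ex.
move=> P phi; rewrite /traj Wz => trajP.
apply: (stopped_at hs W0 l1 hT halpha heps hx trajP) => ns.
have := not_stopped_dist hs Wm beta0 Wlip Wmin0 Wb l1 hT halpha heps hx hTalpha trajP ns.
have -> : phi l 0 = u0.
  by rewrite /u0 -(trajectory_init trajP (Ordinal last_lt)) /= prednK.
rewrite -/r -/B => dist_le; have := le_trans (normr_ge0 _) dist_le.
by rewrite subr_ge0 leNgt BN.
Qed.
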